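(* Let $(A,d_A)$ be a locally finite metric space and let $X$ be a Banach space. Suppose that the finite subsets of $A$ admit uniformly bilipschitz embeddings into $X$, that is, there is a constant $C<\infty$ such that every finite subset $F\subset A$ (with the metric induced from $A$) admits a $C$-bilipschitz embedding into $X$. Then $A$ admits a bilipschitz embedding into $X$.
   Context: A metric space $(A,d_A)$ is called discrete if there exists a constant $\delta>0$ such that $d_A(u,v)\ge\delta$ for all $u,v\in A$ with $u\neq v$. A discrete metric space $A$ is called locally finite if for every $u\in A$ and every $r>0$ the set $\{a\in A: d_A(u,a)\le r\}$ is finite. For $C<\infty$, a map $f:(A,d_A)\to(Y,d_Y)$ between metric spaces is called a $C$-bilipschitz embedding if there exists $r>0$ such that $$\forall u,v\in A\quad r\,d_A(u,v)\le d_Y(f(u),f(v))\le r\,C\,d_A(u,v).$$ The number $r$ may depend on the map. A bilipschitz embedding is a map which is a $C$-bilipschitz embedding for some $C<\infty$. A Banach space is regarded as a metric space with the metric $\|x-y\|$. *)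

(* Defs.v *)
From mathcomp Require Import all_boot all_order all_algebra.
From mathcomp Require Import all_classical all_reals all_analysis.

Set Implicit Arguments.
Unset Strict Implicit.
Unset Printing Implicit Defensive.

Import Order.TTheory GRing.Theory Num.Theory.
Import numFieldNormedType.Exports.

Local Open Scope classical_set_scope.
Local Open Scope ring_scope.

(* This is uniform discreteness, which is stronger than the discreteness of
   the underlying topology. *)
Definition discrete_metric (R : realType) (A : metricType R) : Prop :=
  exists2 delta : R, 0 < delta &
    forall u v : A, u != v -> delta <= mdist u v.

Definition locally_finite (R : realType) (A : metricType R) : Prop :=
  discrete_metric A /\
  forall (u : A) (r : R), 0 < r -> finite_set [set a : A | mdist u a <= r].

(* The distances are explicit arguments because the library declares no
   canonical metricType on subsets of a metric space or on normed modules. *)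
Definition C_bilipschitz_embedding (R : realType) (S Y : Type)
    (dS : S -> S -> R) (dY : Y -> Y -> R) (C : R) (f : S -> Y) : Prop :=
  exists2 r : R, 0 < r &
    forall u v : S, r * dS u v <= dY (f u) (f v) <= r * C * dS u v.

Definition bilipschitz_embedding (R : realType) (S Y : Type)
    (dS : S -> S -> R) (dY : Y -> Y -> R) (f : S -> Y) : Prop :=
  exists C : R, C_bilipschitz_embedding dS dY C f.

Definition induced_dist (R : realType) (A : metricType R) (F : set A)
    (u v : F) : R :=
  mdist (\val u) (\val v).

Definition norm_dist (R : realType) (X : normedModType R) (x y : X) : R :=
  `|x - y|.

Definition finite_subsets_uniformly_bilipschitz (R : realType)
    (A : metricType R) (X : normedModType R) : Prop :=
  exists C : R, forall F : set A, finite_set F ->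
    exists f : F -> X,
      C_bilipschitz_embedding (@induced_dist R A F) (@norm_dist R X) C f.

(* Main.v *)
(* Normalize embeddings [phi i] of the balls [B(o, i)] so that [phi i o = 0] and
   distances grow by a factor between [1] and [C].  On the annulus
   [M^n <= d(o, a) <= 2 M^n] interpolate from [phi i] to [phi j], where [i, j]
   are consecutive terms of a sequence of indices; off these annuli use a single
   [phi i].  Since [|phi i a| <= C d(o, a)], the result is Lipschitz, and with
   [M] large points at very different distances from [o] are automatically
   separated.  The interpolation could still collapse other pairs (think of
   [phi j = - phi i]).  It does not if [i, j] are generic for a nonprincipal
   ultrafilter [U]: differences of interpolated values have the form [p i + q j]
   with [p i + q i = phi i u - phi i v], and a three-index argument shows that
   [|p i + q j| >= d(u, v) / 3] for [U]-almost all [i] and then for [U]-almost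
   all [j]. *)

Require Import Defs.
From mathcomp Require Import all_boot all_order all_algebra.
From mathcomp Require Import all_classical all_reals all_analysis.
From mathcomp Require Import ring lra.

Set Implicit Arguments.
Unset Strict Implicit.
Unset Printing Implicit Defensive.

Import Order.TTheory GRing.Theory Num.Theory.
Import numFieldNormedType.Exports.

Local Open Scope classical_set_scope.
Local Open Scope ring_scope.

(** * Filters and ultrafilters *)

Lemma filter_finite_bigcap (T : Type) (I : choiceType) (D : set I)
    (f : I -> set T) (F : set_system T) {FF : Filter F} : finite_set D ->
  (forall i, D i -> F (f i)) -> F (\bigcap_(i in D) f i).
Proof.
by move=> /finite_fsetP[E ->] FD; apply: filter_bigI => i /FD.
Qed.

(** Dependent choice keeping [s n] good: if [i] is good at [n], then [F]-almost every [j] satisfies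
    [Q n i j] and is good at [n.+1]. *)
Lemma filter_chain (T : Type) (F : set_system T) {FF : ProperFilter F}
    (Q : nat -> T -> T -> Prop) :
  (forall n, \forall i \near F, \forall j \near F, Q n i j) ->
  exists s : nat -> T, forall n, Q n (s n) (s n.+1).
Proof.
move=> FQ.
pose good n := {i | \forall j \near F, Q n i j}.
have next n (i : good n) : exists j : good n.+1, Q n (sval i) (sval j).
  have [j [Qj Gj]] := filter_ex (filterI (svalP i) (FQ n.+1)).
  by exists (exist _ j Gj).
have [i0 G0] := filter_ex (FQ 0).
pose step n (i : good n) : good n.+1 := sval (cid (next n i)).
pose s := fix s n : good n :=
  if n is m.+1 then step m (s m) else exist _ i0 G0.
by exists (fun n => sval (s n)) => n; exact: (svalP (cid (next n (s n)))).
Qed.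

(* If the conclusion failed, then for suitable [i], [j]
   and [k] the three vectors [p i + q j], [p i + q k] and [p j + q k] would have
   norm less than [d / 3], and so would not add up to [p j + q j]. *)
Lemma ultra_norm_separation (R : realType) (X : normedModType R) (T : Type)
    (F : set_system T) {FU : UltraFilter F} (p q : T -> X) (d : R) :
  (\forall i \near F, d <= `|p i + q i|) ->
  \forall i \near F, \forall j \near F, d / 3 <= `|p i + q j|.
Proof.
move=> Fd.
pose small i := [set j | `|p i + q j| < d / 3].
have ultraN i : ~ (\forall j \near F, d / 3 <= `|p i + q j|) -> F (small i).
  move=> nF; have [//|FN] := in_ultra_setVsetC (small i) FU.
  by case: nF; apply: filterS FN => j /negP; rewrite -leNgt.
have [//|FN] := in_ultra_setVsetC
  [set i | \forall j \near F, d / 3 <= `|p i + q j|] FU.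
have {ultraN}FS : F [set i | F (small i)] by apply: filterS FN => i /ultraN.
have /filter_ex[i Fi] := FS.
have [j [[ij Fj] dj]] := filter_ex (filterI (filterI Fi FS) Fd).
have [k [ik jk]] := filter_ex (filterI Fi Fj).
move: ij ik jk; rewrite /small /= => ij ik jk.
have E : p j + q j = (p i + q j) - (p i + q k) + (p j + q k).
  by rewrite opprD (addrACA (p i)) subrr add0r addrCA subrK.
have := ler_normD (p i + q j - (p i + q k)) (p j + q k).
have := ler_normB (p i + q j) (p i + q k).
by rewrite -E; move: dj => /=; lra.
Qed.

(** * Normalized embeddings of finite sets *)

Definition normalized_embedding (R : realType) (A : metricType R)
    (X : normedModType R) (o : A) (C : R) (F : set A) (phi : A -> X) : Prop :=
  phi o = 0 /\ forall u v, F u -> F v ->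
    mdist u v <= `|phi u - phi v| <= C * mdist u v.

Lemma exists_normalized_embedding (R : realType) (A : metricType R)
    (X : normedModType R) : finite_subsets_uniformly_bilipschitz A X ->
  exists2 C : R, 1 <= C & forall (o : A) (F : set A), finite_set F ->
    exists phi : A -> X, normalized_embedding o C F phi.
Proof.
move=> [C0 embF]; exists (Num.max 1 C0); first by rewrite le_max lexx.
move=> o F0 finF0; pose F := F0 `|` [set o].
have /embF[f [r r0 fP]] : finite_set F by rewrite finite_setU.
pose g a : X := if pselect (F a) is left Fa then f (SigSub (mem_set Fa)) else 0.
have gP u v : F u -> F v ->
    r * mdist u v <= `|g u - g v| <= r * C0 * mdist u v.
  rewrite /g => Fu Fv; case: pselect => // Fu'; case: pselect => // Fv'.
  exact: (fP (SigSub (mem_set Fu')) (SigSub (mem_set Fv'))).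
exists (fun a => r^-1 *: (g a - g o)); split; first by rewrite subrr scaler0.
move=> u v Fu Fv; rewrite -scalerBr opprB addrA subrK normrZ.
rewrite gtr0_norm ?invr_gt0//.
have /andP[lo hi] := gP u v (or_introl Fu) (or_introl Fv).
rewrite ler_pdivlMl// lo ler_pdivrMl// (le_trans hi)// mulrA.
by rewrite ler_wpM2r ?mdist_ge0// ler_pM2l// le_max lexx orbT.
Qed.

(** * Interpolation by a cutoff *)

(** For [rho > 0], a ramp in [x]: [0] up to [rho], linear until [2 * rho], then [1]. *)
Definition cutoff (R : realType) (rho x : R) : R :=
  Num.min 1 (Num.max 0 (x / rho - 1)).

Lemma cutoff_bounds (R : realType) (rho x : R) : 0 <= cutoff rho x <= 1.
Proof. by rewrite /cutoff ge_min lexx le_min le_max lexx ler01. Qed.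

Lemma cutoff0 (R : realType) (rho x : R) :
  0 < rho -> x <= rho -> cutoff rho x = 0.
Proof.
move=> rho0 xrho; rewrite /cutoff max_l ?min_r// subr_le0 ler_pdivrMr//.
by rewrite mul1r.
Qed.

Lemma cutoff1 (R : realType) (rho x : R) :
  0 < rho -> 2 * rho <= x -> cutoff rho x = 1.
Proof.
move=> rho0 xrho; rewrite /cutoff min_l// le_max lerBrDr ler_pdivlMr//.
by rewrite xrho orbT.
Qed.

(** The slope is at most [1 / rho] and vanishes beyond [2 * rho]. The weight [x] absorbs the size
    [2 * C * mdist o u] of [phi u - psi u] in [glue_lip]. *)
Lemma cutoff_lip (R : realType) (rho x y : R) :
  0 < rho -> 0 <= x <= y -> x * `|cutoff rho y - cutoff rho x| <= 2 * (y - x).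
Proof.
move=> rho0 /andP[x0 xy].
have [big|small] := leP (2 * rho) x.
  by rewrite !cutoff1// ?(le_trans big)// subrr normr0 mulr0; lra.
have xyr : x / rho <= y / rho by rewrite ler_pM2r ?invr_gt0.
have lip : `|cutoff rho y - cutoff rho x| <= (y - x) / rho.
  rewrite mulrBl /cutoff !minElt !maxElt.
  move: (x / rho) (y / rho) xyr => a b ab.
  by case: (ltP 0 (b - 1)) => ?; case: (ltP 0 (a - 1)) => ?; rewrite ?ltr10;
    case: (ltP 1 (b - 1)) => ?; case: (ltP 1 (a - 1)) => ?;
    rewrite ?ltr10 ler_norml; apply/andP; split; lra.
apply: (le_trans (ler_wpM2l x0 lip)).
rewrite mulrA ler_pdivrMr//.
have yx : 0 <= y - x by lra.
have := ler_wpM2r yx (ltW small); lra.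
Qed.

Definition glue (R : realType) (A : Type) (X : normedModType R) (t : A -> R)
    (phi psi : A -> X) (a : A) : X :=
  (1 - t a) *: phi a + t a *: psi a.

Lemma normalized_embedding_norm (R : realType) (A : metricType R)
    (X : normedModType R) (o : A) (C : R) (F : set A) (phi : A -> X) (a : A) :
  F o -> normalized_embedding o C F phi -> F a -> `|phi a| <= C * mdist o a.
Proof.
move=> Fo [phi0 phiP] Fa; have /andP[_] := phiP a o Fa Fo.
by rewrite phi0 subr0 metric_sym.
Qed.

Lemma glue_norm (R : realType) (A : Type) (X : normedModType R) (t : A -> R)
    (phi psi : A -> X) (a : A) (b : R) : 0 <= t a <= 1 ->
  `|phi a| <= b -> `|psi a| <= b -> `|glue t phi psi a| <= b.
Proof.
move=> /andP[t0 t1] pa qa; rewrite /glue (le_trans (ler_normD _ _))//.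
rewrite !normrZ ger0_norm ?subr_ge0// (ger0_norm t0).
have t1' : 0 <= 1 - t a by rewrite subr_ge0.
have := ler_wpM2l t1' pa; have := ler_wpM2l t0 qa; lra.
Qed.

(** With [u] the point nearer to [o], the increment is a convex combination of those of [phi] and
    [psi], at most [C * mdist u v], plus [(t - s) *: (phi u - psi u)], at most [4 * C * mdist u v]
    by [cutoff_lip]. *)
Lemma glue_lip (R : realType) (A : metricType R) (X : normedModType R) (o : A)
    (C rho : R) (F : set A) (phi psi : A -> X) : 0 <= C -> 0 < rho -> F o ->
  normalized_embedding o C F phi -> normalized_embedding o C F psi ->
  let g := glue (fun a => cutoff rho (mdist o a)) phi psi in
  forall u v, F u -> F v -> `|g u - g v| <= 5 * C * mdist u v.
Proof.
move=> C0 rho0 Fo phiP psiP g u v.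
wlog uv : u v / mdist o u <= mdist o v.
  move=> H Fu Fv; have [?|/ltW ?] := leP (mdist o u) (mdist o v).
    exact: H.
  by rewrite distrC metric_sym; exact: H.
move=> Fu Fv; rewrite /g /glue.
have := cutoff_lip rho0 (_ : 0 <= mdist o u <= mdist o v).
rewrite mdist_ge0 uv => /(_ isT).
have /andP[t0 t1] := cutoff_bounds rho (mdist o v).
set s := cutoff _ (mdist o u); move: t0 t1.
set t := cutoff _ (mdist o v) => t0 t1 lip.
have -> : (1 - s) *: phi u + s *: psi u - ((1 - t) *: phi v + t *: psi v) =
    ((1 - t) *: (phi u - phi v) + t *: (psi u - psi v)) +
    (t - s) *: (phi u - psi u).
  have -> : (1 - s) *: phi u + s *: psi u =
      (1 - t) *: phi u + t *: psi u + (t - s) *: (phi u - psi u).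
    rewrite scalerBr addrACA -scalerDl -scalerBl.
    by congr (_ *: _ + _ *: _); ring.
  by rewrite addrAC opprD addrACA -!scalerBr.
have tri := metric_triangle o u v.
have phiu := normalized_embedding_norm Fo phiP Fu.
have psiu := normalized_embedding_norm Fo psiP Fu.
have /andP[_ phiuv] := phiP.2 u v Fu Fv.
have /andP[_ psiuv] := psiP.2 u v Fu Fv.
have convex := glue_norm (t := fun=> t) (phi := fun=> phi u - phi v)
  (psi := fun=> psi u - psi v) (a := tt) (_ : 0 <= t <= 1) phiuv psiuv.
have shift : `|(t - s) *: (phi u - psi u)| <= 4 * C * mdist u v.
  rewrite normrZ.
  have diff := le_trans (ler_normB (phi u) (psi u)) (lerD phiu psiu).
  apply: (le_trans (ler_wpM2l (normr_ge0 _) diff)).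
  have := ler_wpM2l C0 lip; have := ler_wpM2l C0 tri; lra.
rewrite (le_trans (ler_normD _ _))//.
have := convex _; rewrite t0 t1 /glue => /(_ isT).
lra.
Qed.

(** * Patching along annuli *)

(** Each point uses the [g n] of the smallest ball containing it. Pairs at comparable distances from
    [o] fall under a single [g n], other pairs under the triangle inequality. *)
Lemma bilipschitz_patching (R : realType) (A : metricType R)
    (X : normedModType R) (o : A) (C : R) (g : nat -> A -> X) : 1 <= C ->
  (forall n u v, mdist o u <= (12 * C) ^+ n.+1 ->
     mdist o v <= (12 * C) ^+ n.+1 ->
     mdist u v / 3 <= `|g n u - g n v| <= 5 * C * mdist u v) ->
  (forall n u, mdist o u <= (12 * C) ^+ n.+1 -> `|g n u| <= C * mdist o u) ->
  (forall n u, 2 * (12 * C) ^+ n <= mdist o u <= (12 * C) ^+ n.+1 ->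
     g n u = g n.+1 u) ->
  exists f : A -> X, bilipschitz_embedding (@mdist R A) (@norm_dist R X) f.
Proof.
move=> C1 gP gle gS; set M := 12 * C in gP gle gS.
have M1 : 1 <= M by rewrite /M; lra.
have M0 : 0 < M by lra.
have exn a : exists n, mdist o a <= M ^+ n.+1.
  exists (Num.bound (mdist o a)).
  rewrite (le_trans (ltW (upper_nthrootP (leqnSn _))))//.
  by rewrite lerXn2r ?nnegrE ?ltW// /M; lra.
pose N a := ex_minn (exn a).
pose f a := g (N a) a.
have NP a : mdist o a <= M ^+ (N a).+1 by rewrite /N; case: ex_minnP.
have Nmin a n : mdist o a <= M ^+ n.+1 -> (N a <= n)%N.
  by rewrite /N; case: ex_minnP => m _; exact.
(* The second condition forces [N a] to be [n] or [n.-1]; in the latter case [gS] applies. *)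
have fE a n : mdist o a <= M ^+ n.+1 ->
    (n == 0%N) || (2 * M ^+ n.-1 <= mdist o a) -> f a = g n a.
  move=> an; have := Nmin _ _ an; rewrite leq_eqVlt => /orP[/eqP <-//|Nn].
  case: n an Nn => // n an; rewrite ltnS leq_eqVlt /= => /orP[/eqP Nn|Nn] na.
    by rewrite /f Nn gS// na -Nn NP.
  have NMn : M ^+ (N a).+1 <= M ^+ n by rewrite ler_weXn2l.
  have Mn0 : 0 < M ^+ n by rewrite exprn_gt0.
  by exfalso; have := NP a; lra.
have fo0 a : `|f a| <= C * mdist o a by exact: gle.
have fo1 a : mdist o a / 3 <= `|f a|.
  have oN : mdist o o <= M ^+ (N a).+1 by rewrite mdistxx exprn_ge0// ltW.
  have := gle (N a) o oN; rewrite mdistxx mulr0 normr_le0 => /eqP go.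
  by have /andP[+ _] := gP _ _ _ oN (NP a); rewrite go sub0r normrN.
(* In the far case below, with [x = mdist o v], the images differ by at least [x / 3 - x / 6], while
   [mdist u v <= 7 * x / 6]; hence [7^-1]. *)
exists f, (35 * C), (7^-1); first by rewrite invr_gt0.
move=> u v; rewrite /norm_dist.
wlog uv : u v / mdist o u <= mdist o v.
  move=> H; have [?|/ltW ?] := leP (mdist o u) (mdist o v); first exact: H.
  by rewrite distrC metric_sym; exact: H.
have -> : 7^-1 * (35 * C) * mdist u v = 5 * C * mdist u v by lra.
have d0 := mdist_ge0 u v.
(* Since [M = 2 * (6 * C)], points whose distances to [o] differ by a factor of
   at most [6 * C] are both mapped by the same [g n]. *)
have [near|far] := leP (mdist o v) (6 * C * mdist o u).
  rewrite (@fE u (N v)) ?(le_trans uv (NP v))//.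
    have /andP[lo ->] := gP _ _ _ (le_trans uv (NP v)) (NP v).
    by rewrite andbT (le_trans _ lo)//; lra.
  case E : (N v) => [//|m] /=.
  have : M ^+ m.+1 < mdist o v.
    by rewrite ltNge; apply/negP => /Nmin; rewrite E ltnn.
  rewrite exprS => mv; have := lt_le_trans mv near.
  have -> : M * M ^+ m = 6 * C * (2 * M ^+ m) by rewrite /M; ring.
  by rewrite ltr_pM2l; [exact: ltW|lra].
have tri1 := metric_triangle u o v; rewrite (metric_sym u o) in tri1.
have tri2 := metric_triangle o u v.
have fu := fo0 u; have fv := fo0 v; have fv' := fo1 v.
have u0 := mdist_ge0 o u.
have Cu : mdist o u <= C * mdist o u by rewrite ler_peMl.
apply/andP; split.
  have := lerB_dist (f v) (f u); rewrite (distrC (f v)).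
  lra.
rewrite (le_trans (ler_normB _ _))//.
have : C * (mdist o u + mdist o v) <= 5 * C * mdist u v.
  rewrite -mulrA (mulrCA 5) ler_wpM2l; lra.
lra.
Qed.

(** * Generic indices *)

(** For a fixed pair the difference splits into a term in [i] and a term in [j]; for [j = i] the
    weights add up to [1], so [ultra_norm_separation] applies. Finiteness of [D] handles all pairs
    at once. *)
Lemma glue_separated (R : realType) (A : metricType R) (X : normedModType R)
    (o : A) (C : R) (D : set A) (t : A -> R) (T : Type) (F : set_system T)
    {FU : UltraFilter F} (phi : T -> A -> X) : finite_set D ->
  (\forall i \near F, normalized_embedding o C D (phi i)) ->
  \forall i \near F, \forall j \near F, forall u v, D u -> D v ->
    mdist u v / 3 <=
    `|glue t (phi i) (phi j) u - glue t (phi i) (phi j) v|.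
Proof.
move=> finD Fphi.
pose p u v i := (1 - t u) *: phi i u - (1 - t v) *: phi i v.
pose q u v j := t u *: phi j u - t v *: phi j v.
have glueE i j u v :
    glue t (phi i) (phi j) u - glue t (phi i) (phi j) v = p u v i + q u v j.
  by rewrite /glue opprD addrACA.
have pqE i u v : p u v i + q u v i = phi i u - phi i v.
  by rewrite -glueE /glue -!scalerDl !subrK !scale1r.
have sep uv : (D `*` D) uv -> \forall i \near F, \forall j \near F,
    mdist uv.1 uv.2 / 3 <= `|p uv.1 uv.2 i + q uv.1 uv.2 j|.
  case: uv => u v [/= Du Dv]; apply: ultra_norm_separation.
  by apply: filterS Fphi => i [_ /(_ u v Du Dv)/andP[+ _]]; rewrite pqE.
have finDD : finite_set (D `*` D) by exact: finite_setX.
apply: filterS (filter_finite_bigcap finDD sep) => i sepi.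
have {}sepi uv : (D `*` D) uv -> \forall j \near F,
    mdist uv.1 uv.2 / 3 <= `|p uv.1 uv.2 i + q uv.1 uv.2 j| by exact: sepi.
apply: filterS (filter_finite_bigcap finDD sepi) => j Hj u v Du Dv.
by rewrite glueE; exact: (Hj (u, v)).
Qed.

Theorem theorem1p2 (R : realType) (A : metricType R)
    (X : completeNormedModType R) :
  locally_finite A ->
  finite_subsets_uniformly_bilipschitz A X ->
  exists f : A -> X,
    bilipschitz_embedding (@mdist R A) (@norm_dist R X) f.
Proof.
move=> [_ finA] /exists_normalized_embedding[C C1 embC].
have [[ o _]|/forallNP A0] := pselect (exists o : A, True); last first.
  by exists (fun=> 0), 1, 1 => // u; case: (A0 u).
pose D (r : R) := [set a | mdist o a <= r].
have finD r : finite_set (D r).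
  (* Local finiteness speaks of positive radii only, hence the maximum. *)
  apply: sub_finite_set (finA o (Num.max 1 r) _); last by rewrite lt_max ltr01.
  by move=> a /= ar; rewrite le_max ar orbT.
have /choice[phi phiP] := fun i : nat => embC o _ (finD i%:R).
(* [U] contains all tails of [nat], so each ball about [o] lies in [D i%:R] for [U]-almost all
   [i]. *)
have [U [UU Uoo]] := @ultraFilterLemma nat \oo _.
have phiU r : \forall i \near U, normalized_embedding o C (D r) (phi i).
  apply: Uoo; exists (Num.bound `|r|) => // i /= ri.
  have rD a : D r a -> D i%:R a.
    move=> /le_trans; apply; rewrite (le_trans (ler_norm _))//.
    by rewrite (le_trans (ltW (archi_boundP (normr_ge0 r))))// ler_nat.
  by split=> [|u v /rD Du /rD Dv]; [exact: (phiP i).1|exact: (phiP i).2].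
have M0 : 0 < 12 * C by lra.
pose t n a := cutoff ((12 * C) ^+ n) (mdist o a).
pose B n := D ((12 * C) ^+ n.+1).
pose G n i j := glue (t n) (phi i) (phi j).
pose Q n i j := [/\ normalized_embedding o C (B n) (phi i),
  normalized_embedding o C (B n) (phi j) &
  forall u v, B n u -> B n v -> mdist u v / 3 <= `|G n i j u - G n i j v|].
have [s sQ] : exists s : nat -> nat, forall n, Q n (s n) (s n.+1).
  apply: (@filter_chain _ U) => n.
  have phiUn := phiU ((12 * C) ^+ n.+1).
  apply: filterS2 _ (phiUn) (glue_separated (t n) (finD _) phiUn).
  by move=> i phii sepi; apply: filterS2 _ phiUn sepi => j phij sepij.
pose g n := G n (s n) (s n.+1).
have Do n : D ((12 * C) ^+ n) o by rewrite /D /= mdistxx exprn_ge0// ltW.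
apply: (@bilipschitz_patching _ _ _ o C g) => //.
- move=> n u v Du Dv; have [phin phin1 sep] := sQ n.
  apply/andP; split; first exact: sep.
  have C0 : 0 <= C by lra.
  exact: (glue_lip C0 (exprn_gt0 n M0) (Do n.+1) phin phin1 Du Dv).
- move=> n u Du; have [phin phin1 _] := sQ n.
  apply: glue_norm; first exact: cutoff_bounds.
    exact: (normalized_embedding_norm (Do n.+1) phin Du).
  exact: (normalized_embedding_norm (Do n.+1) phin1 Du).
(* Here the ramp of level [n] has reached [1] and that of level [n.+1] is still [0], so both sides
   are [phi (s n.+1) u]. *)
- move=> n u /andP[lo hi]; rewrite /g /G /glue /t cutoff1 ?cutoff0 ?exprn_gt0//.
  by rewrite subrr subr0 !scale0r addr0 add0r.
Qed.
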